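(* Let $M=(\mathcal{S},\mathcal{A},H,P,r,\mu)$ be a finite-horizon MDP with $\mathcal{S}\times\mathcal{A}$ compact, let $\boldsymbol\phi:\mathcal{S}\times\mathcal{A}\to\mathbb{R}^d$ be a feature map, and fix $h\in[H]$. The following two statements are equivalent. (1) There exist $d$ finite signed Borel measures $\boldsymbol\mu_h=(\mu_h^1,\dots,\mu_h^d)$ on $\mathcal{S}$ and a vector $\boldsymbol\theta_h\in\mathbb{R}^d$ such that for all $(s,a)\in\mathcal{S}\times\mathcal{A}$, $P(\cdot\mid h,s,a)=\boldsymbol\phi(s,a)^{\mathsf T}\boldsymbol\mu_h(\cdot)$ (equality of measures) and $r(h,s,a)=\boldsymbol\phi(s,a)^{\mathsf T}\boldsymbol\theta_h$. (2) There is a constant $C>0$ such that for every $f\in C(\mathcal{S})$ there exists $\boldsymbol\omega_{f,h}\in\mathbb{R}^d$ with $$(\mathcal{T}_hf)(s,a):=r(h,s,a)+\mathbb{E}_{s'\sim P(\cdot\mid h,s,a)}[f(s')]=\boldsymbol\phi(s,a)^{\mathsf T}\boldsymbol\omega_{f,h}\quad\text{for all }(s,a)\in\mathcal{S}\times\mathcal{A},$$ and $\|\boldsymbol\omega_{f,h}\|\le C(\|f\|_{C(\mathcal{S})}+1)$, where $\|\cdot\|$ is the Euclidean norm on $\mathbb{R}^d$.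
   Context: A finite-horizon MDP $M=(\mathcal{S},\mathcal{A},H,P,r,\mu)$ consists of a state space $\mathcal{S}$ and action space $\mathcal{A}$ (subsets of Euclidean spaces), a horizon $H$, Borel transition probabilities $P(\cdot\mid h,s,a)$ on $\mathcal{S}$ for $(h,s,a)\in[H]\times\mathcal{S}\times\mathcal{A}$, a deterministic continuous reward $r:[H]\times\mathcal{S}\times\mathcal{A}\to[0,1]$, and an initial distribution $\mu$. $C(\mathcal{S})$ denotes the bounded continuous real functions on $\mathcal{S}$ with the sup norm $\|\cdot\|_{C(\mathcal{S})}$. *)

(* Defs.v *)
From HB Require Import structures.
From mathcomp Require Import all_boot all_order all_algebra.
From mathcomp Require Import all_classical all_reals all_analysis.
Set Implicit Arguments. Unset Strict Implicit. Unset Printing Implicit Defensive.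
Import Order.TTheory GRing.Theory Num.Theory.
Import numFieldNormedType.Exports.
Local Open Scope classical_set_scope.
Local Open Scope ring_scope.

(* Euclidean space R^n is 'rV[R]_n (with its product = Euclidean topology).
   [Borel R n] is R^n equipped with its Borel sigma-algebra (generated by the
   open sets). *)
Definition Borel (R : realType) (n : nat) := g_sigma_algebraType (@open 'rV[R]_n).

Definition euclid_norm (R : realType) (d : nat) (w : 'rV[R]_d) : R :=
  Num.sqrt (\sum_(i < d) (w ord0 i) ^+ 2).

Definition dotv (R : realType) (d : nat) (u w : 'rV[R]_d) : R :=
  \sum_(i < d) u ord0 i * w ord0 i.

(* A (signed) set function on Borel(R^n) "lives on S": it vanishes on every
   Borel set disjoint from S.  A Borel (signed) measure on S is represented as
   a (signed) measure on Borel(R^n) living on S. *)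
Definition lives_on (R : realType) (n : nat) (S : set 'rV[R]_n)
  (nu : set (Borel R n) -> \bar R) : Prop :=
  forall B : set (Borel R n), measurable B -> B `&` S = set0 -> nu B = 0%E.

(* f belongs to C(S): bounded and continuous on S (values off S irrelevant) *)
Definition in_CS (R : realType) (n : nat) (S : set 'rV[R]_n) (f : 'rV[R]_n -> R) : Prop :=
  {within S, continuous f} /\ exists M : R, forall s, S s -> `|f s| <= M.

Definition supnorm (R : realType) (n : nat) (S : set 'rV[R]_n) (f : 'rV[R]_n -> R) : R :=
  sup [set `|f s| | s in S].

Definition is_MDP (R : realType) (n m : nat) (S : set 'rV[R]_n) (A : set 'rV[R]_m)
  (H : nat) (P : nat -> 'rV[R]_n -> 'rV[R]_m -> probability (Borel R n) R)
  (r : nat -> 'rV[R]_n -> 'rV[R]_m -> R) (mu : probability (Borel R n) R) : Prop :=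
  [/\ (forall h s a, (1 <= h <= H)%N -> S s -> A a -> lives_on S (P h s a)),
      (forall h, (1 <= h <= H)%N ->
          {within S `*` A, continuous (fun sa : 'rV[R]_n * 'rV[R]_m => r h sa.1 sa.2)}),
      (forall h s a, (1 <= h <= H)%N -> S s -> A a -> 0 <= r h s a <= 1) &
      lives_on S mu].

(* Main.v *)
(** From (1) to (2), take [w = theta + (\int f dmu_h^i)_i], with integrals
    against signed measures read through Jordan decompositions; the norm bound
    comes from the total variations.

    From (2) to (1), no representation theorem is needed.  Finitely many pairs
    [(s_j, a_j)] have feature vectors spanning all the others, so
    [phi(s,a) = \sum_j c_j phi(s_j,a_j)] with [c] linear in [phi(s,a)].
    Statement (2) for [f = 0] gives [r(s,a) = \sum_j c_j r(s_j,a_j)], and then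
    for a general [f] that [P(.|s,a)] and [\sum_j c_j P(.|s_j,a_j)] have the
    same integral of [f].  Continuous functions approximate indicators of open
    sets, so these signed measures coincide, and the measures [mu_h^i] are
    combinations of the [P(.|s_j,a_j)]. *)

Require Import Defs.
From HB Require Import structures.
From mathcomp Require Import all_boot all_order all_algebra.
From mathcomp Require Import all_classical all_reals all_analysis.
From mathcomp Require Import measurable_realfun lra.
Import Order.TTheory GRing.Theory Num.Theory.
Import numFieldNormedType.Exports.
Local Open Scope classical_set_scope.
Local Open Scope ring_scope.

(** * Linear combinations of measures and of charges *)

Section linear_combinations.
Context {d : measure_display} {T : measurableType d} {R : realType}.
Implicit Types (I : Type) (D : set T).

(** Nonnegative coefficients keep the sum a genuine measure, to which uniqueness and integration
    results for measures apply. Integrals of nonnegative functions add up without any integrability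
    condition. *)
Lemma conic_combination_measure I (s : seq I) (c : I -> {nonneg R})
    (nu : I -> {measure set T -> \bar R}) :
  exists m : {measure set T -> \bar R},
    (forall B, m B = \sum_(i <- s) (c i)%:num%:E * nu i B)%E /\
    (forall D (f : T -> \bar R), measurable D -> measurable_fun D f ->
      (forall x, D x -> (0 <= f x)%E) ->
      \int[m]_(x in D) f x =
        \sum_(i <- s) (c i)%:num%:E * \int[nu i]_(x in D) f x)%E.
Proof.
elim: s => [|i s [m [mE im]]].
  exists mzero; split=> [B|D f mD mf f0]; rewrite big_nil //.
  by rewrite integral_measure_zero.
exists (measure_add (mscale (c i) (nu i)) m); split=> [B|D f mD mf f0].
  by rewrite [LHS]measure_addE big_cons -mE.
by rewrite ge0_integral_measure_add// ge0_integral_mscale// big_cons -im.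
Qed.

Lemma charge_linear_combination I (s : seq I) (c : I -> R)
    (nu : I -> {charge set T -> \bar R}) :
  exists m : {charge set T -> \bar R},
    forall B, m B = (\sum_(i <- s) (c i)%:E * nu i B)%E.
Proof.
elim: s => [|i s [m mE]]; first by exists czero => B; rewrite big_nil.
by exists (cadd (cscale (c i) (nu i)) m) => B; rewrite big_cons -mE.
Qed.

Definition nneg_part (x : R) : {nonneg R} :=
  NngNum (ltac:(by rewrite le_max lexx orbT) : 0 <= Num.max x 0).

Lemma nneg_partB (x : R) : (nneg_part x)%:num - (nneg_part (- x))%:num = x.
Proof.
rewrite /=; case: (leP 0 x) => x0.
  by rewrite max_r ?oppr_le0// subr0.
by rewrite max_l ?oppr_ge0 1?ltW// sub0r opprK.
Qed.

(* Moving the negative coefficients to the other side turns a relation between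
   signed measures into an equality of two positive ones. *)
Lemma signed_sum_eq0P I (s : seq I) (c : I -> R) (x : I -> \bar R) :
  (forall i, x i \is a fin_num) ->
  \sum_(i <- s) c i * fine (x i) = 0 <->
  (\sum_(i <- s) (nneg_part (c i))%:num%:E * x i =
   \sum_(i <- s) (nneg_part (- c i))%:num%:E * x i)%E.
Proof.
move=> xfin; pose P := \sum_(i <- s) (nneg_part (c i))%:num * fine (x i).
pose N := \sum_(i <- s) (nneg_part (- c i))%:num * fine (x i).
have EE (k : I -> R) : (\sum_(i <- s) (k i)%:E * x i)%E =
    (\sum_(i <- s) k i * fine (x i))%:E.
  rewrite -sumEFin; apply: eq_bigr => i _.
  by rewrite EFinM fineK.
have -> : \sum_(i <- s) c i * fine (x i) = P - N.
  by rewrite -sumrB; apply: eq_bigr => i _; rewrite -mulrBl nneg_partB.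
by rewrite !EE -/P -/N; split=> [/eqP|[->]]; rewrite ?subr_eq0 ?subrr// => /eqP->.
Qed.

Variables (I : Type) (s : seq I) (c : I -> R).
Variable nu : I -> {finite_measure set T -> \bar R}.

(** Splitting the coefficients by sign gives two positive measures that agree on measurable sets,
    hence have equal integrals of nonnegative functions; a shift by [M] reduces [f] to that case. *)
Lemma signed_sum_integral0 D (f : T -> R) (M : R) :
  (forall B, measurable B -> \sum_(i <- s) c i * fine (nu i B) = 0) ->
  measurable D -> measurable_fun D f -> (forall x, D x -> `|f x| <= M) ->
  \sum_(i <- s) c i * \int[nu i]_(x in D) f x = 0.
Proof.
move=> nu0 mD mf fM.
have [m1 [m1E im1]] := conic_combination_measure _ s (nneg_part \o c) nu.
have [m2 [m2E im2]] :=
  conic_combination_measure _ s (nneg_part \o -%R \o c) nu.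
have m12 B : measurable B -> m1 B = m2 B.
  move=> mB; rewrite m1E m2E; apply/signed_sum_eq0P; last exact: nu0.
  by move=> i; exact: fin_num_measure.
have bint i (g : T -> R) K : measurable_fun D g -> (forall x, D x -> `|g x| <= K) ->
    (nu i).-integrable D (EFin \o g).
  move=> mg gK; apply: measurable_bounded_integrable => //.
    by rewrite ltey_eq fin_num_measure.
  exists K; split; first exact: num_real.
  by move=> K' /ltW KK' x Dx; exact: le_trans (gK x Dx) KK'.
have pos (g : T -> R) K : measurable_fun D g -> (forall x, D x -> 0 <= g x <= K) ->
    \sum_(i <- s) c i * \int[nu i]_(x in D) g x = 0.
  move=> mg gK; apply/signed_sum_eq0P.
    move=> i; apply: integrable_fin_num => //; apply: (bint _ _ K) => // x Dx.
    by have /andP[g0 gK'] := gK x Dx; rewrite ger0_norm.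
  have mg' : measurable_fun D (EFin \o g) by exact/measurable_EFinP.
  have g0 x : D x -> (0 <= (EFin \o g) x)%E.
    by move=> Dx; rewrite lee_fin; have /andP[] := gK x Dx.
  rewrite -[LHS](im1 _ _ mD mg' g0) -[RHS](im2 _ _ mD mg' g0).
  by apply: eq_measure_integral => B mB _; exact: m12.
have M0 x : D x -> 0 <= M by move=> Dx; exact: le_trans (fM x Dx).
(* [f + M] takes values between [0] and [M + M]; the constant [M] is handled the same way and then
   subtracted. *)
have fMM : \sum_(i <- s) c i * \int[nu i]_(x in D) (f x + M) = 0.
  apply: (pos _ (M + M)); first exact: measurable_funD.
  move=> x Dx; have := fM x Dx; rewrite ler_norml => /andP[Mf fM'].
  by rewrite -lerBlDr sub0r Mf lerD2r.
have MM : \sum_(i <- s) c i * \int[nu i]_(x in D) M = 0.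
  by apply: (pos _ M) => // x Dx; rewrite (M0 x Dx) lexx.
transitivity (\sum_(i <- s) (c i * \int[nu i]_(x in D) f x +
    c i * \int[nu i]_(x in D) M)); first by rewrite big_split/= MM addr0.
rewrite -[RHS]fMM; apply: eq_bigr => i _.
rewrite -mulrDr RintegralD//; first exact: (bint _ _ M).
by apply: (bint _ _ M) => // x Dx; rewrite ger0_norm// (M0 x).
Qed.

End linear_combinations.

(** * Borel measures on Euclidean space and continuous functions *)

Section borel_euclidean.
Context {R : realType} {n : nat}.

Lemma open_Borel (O : set 'rV[R]_n) : open O -> measurable (O : set (Borel R n)).
Proof. by move=> oO; exact: sub_sigma_algebra. Qed.

Lemma closed_Borel (F : set 'rV[R]_n) :
  closed F -> measurable (F : set (Borel R n)).
Proof.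
by move=> /closed_openC/open_Borel/(@measurableC _ (Borel R n)); rewrite setCK.
Qed.

Lemma within_continuous_measurable (S : set 'rV[R]_n) (f : 'rV[R]_n -> R) :
  measurable (S : set (Borel R n)) -> {within S, continuous f} ->
  measurable_fun (S : set (Borel R n)) (f : Borel R n -> R).
Proof.
move=> mS /continuousP cf; apply: (measurability _ (RGenOpens.measurableE R)).
move=> _ [_ [a [b ->] <-]].
have /open_subspaceP [V oV VS] : open (from_subspace S f @^-1` `]a, b[%classic).
  by apply: cf; exact: interval_open.
by rewrite setIC -VS; apply: measurableI => //; exact: open_Borel.
Qed.

Lemma edist_inf_fin_num (F : set 'rV[R]_n) (x : 'rV[R]_n) :
  F !=set0 -> edist_inf F x \is a fin_num.
Proof.
move=> [a Fa]; rewrite ge0_fin_numE ?edist_inf_ge0//.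
apply: (@le_lt_trans _ _ (edist (x, a))).
  by apply: ereal_inf_lbound; exists a.
rewrite -ge0_fin_numE ?edist_ge0//; apply/edist_finP; exists (`|x - a| + 1) => /=.
  by rewrite ltr_wpDl.
by rewrite -ball_normE /= ltrDl.
Qed.

Lemma edist_inf_gt0 (F : set 'rV[R]_n) (x : 'rV[R]_n) :
  closed F -> ~ F x -> (0 < edist_inf F x)%E.
Proof.
move=> /closed_openC oF Fx.
have : nbhs x (~` F) by exact: open_nbhs_nbhs.
move=> /nbhs_ballP[e /= e0 be]; apply: (@lt_le_trans _ _ e%:E).
  by rewrite lte_fin.
rewrite leNgt; apply/negP => /ereal_inf_lt[_ [a Fa <-]] /edist_lt_ball/= xa.
exact: be xa Fa.
Qed.

(** The functions are [min(1, k * D x)], with [D x] the distance to the complement of [O]: zero off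
    [O], and equal to [1] on [O] once [k] exceeds the inverse of [D x]. *)
Lemma open_indicator_approximation (O : set 'rV[R]_n) : open O ->
  exists g : nat -> 'rV[R]_n -> R,
    [/\ forall k, continuous (g k), forall k x, 0 <= g k x <= 1 &
        forall x, g k x @[k --> \oo] --> (\1_O x : R)].
Proof.
move=> oO; have cF := open_closedC oO.
(* The distance to an empty complement would be infinite, so the whole space is treated apart. *)
have [F0|/set0P F0] := eqVneq (~` O) set0.
  exists (fun _ _ => 1); split.
  - by move=> _; exact: cst_continuous.
  - by move=> _ _; rewrite ler01 lexx.
  - move=> x; rewrite indicE mem_set; first exact: cvg_cst.
    by apply: contrapT => Ox; have : (~` O) x by []; rewrite F0.
pose D (x : 'rV[R]_n) := fine (edist_inf (~` O) x).
have D0 x : 0 <= D x by rewrite fine_ge0// edist_inf_ge0.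
exists (fun k => (fun=> 1) \min (fun x => k%:R * D x)); split.
- move=> k x; apply: continuous_min; first exact: cst_continuous.
  apply: (@cvgM R _ (nbhs x)); first by apply: cvg_cst; exact: nbhs_filter.
  apply: fine_cvg; rewrite fineK ?edist_inf_fin_num//.
  exact: edist_inf_continuous.
- move=> k x /=; rewrite le_min ge_min lexx/= ler01/= andbT.
  by rewrite mulr_ge0.
- move=> x; apply: cvg_near_cst; rewrite indicE.
  have [/set_mem Ox|Ox] := boolP (x \in O).
    have Dx : 0 < D x.
      rewrite fine_gt0// ltey_eq edist_inf_fin_num// andbT.
      by apply: edist_inf_gt0 => // /(_ Ox).
    exists (Num.truncn (D x)^-1).+1 => // k /= hk; apply: min_l.
    rewrite -ler_pdivrMr// div1r; apply: (le_trans (ltW (truncnS_gt _))).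
    by rewrite ler_nat.
  near=> k; rewrite /= min_r ?/D ?edist_inf0 ?fine0 ?mulr0//;
    by move: Ox; rewrite notin_setE.
Unshelve. all: by end_near. Qed.

Variables (I : Type) (s : seq I) (c : I -> R).
Variable nu : I -> {finite_measure set (Borel R n) -> \bar R}.

(** Dominated convergence passes from continuous functions to open sets; the sign splitting then
    reduces Borel sets to the uniqueness of finite positive measures. *)
Lemma signed_sum_measure0 (S : set 'rV[R]_n) :
  closed S -> (forall i, lives_on S (nu i)) ->
  (forall f : 'rV[R]_n -> R, in_CS S f ->
    \sum_(i <- s) c i * \int[nu i]_(x in S) f x = 0) ->
  forall B, measurable B -> \sum_(i <- s) c i * fine (nu i B) = 0.
Proof.
move=> cS nuS int0; have mS := closed_Borel _ cS.
have openP (O : set 'rV[R]_n) : open O -> \sum_(i <- s) c i * fine (nu i O) = 0.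
  move=> oO; have mO := open_Borel _ oO.
  have [g [cg g01 gO]] := open_indicator_approximation _ oO.
  have mg k : measurable_fun (S : set (Borel R n)) (g k : Borel R n -> R).
    by apply: within_continuous_measurable => //; exact: continuous_subspaceT.
  have lim i : \int[nu i]_(x in S) g k x @[k --> \oo] --> fine (nu i O).
    apply: fine_cvg; rewrite fineK ?fin_num_measure//.
    (* The part of [O] outside [S] has measure zero because [nu i] lives on [S]. *)
    have -> : nu i O = (\int[nu i]_(x in S) (\1_O x)%:E)%E.
      rewrite integral_indic// -{1}(setUIDK O S) measureU//; first last.
      - by rewrite setDE setIACA setICr setI0.
      - exact: measurableD.
      - exact: measurableI.
      rewrite [X in (_ + X)%E](nuS i)// ?adde0//; first exact: measurableD.
      by rewrite setDE -setIA setICl setI0.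
    have [//|//||||] := @dominated_convergence _ (Borel R n) R (nu i) S mS
      (fun k x => (g k x)%:E) (fun x => (\1_O x)%:E) (cst 1%E).
    + by move=> k; exact/measurable_EFinP.
    + by apply/measurable_EFinP; exact: measurable_indic.
    + by apply: aeW => x _; apply: cvg_EFin; [exact: nearW|exact: gO].
    + by apply: finite_measure_integrable_cst.
    + apply: aeW => x k _; rewrite lee_fin; have /andP[? ?] := g01 k x.
      by rewrite ger0_norm.
    + by [].
  have : (\sum_(i <- s) c i * \int[nu i]_(x in S) g k x) @[k --> \oo] -->
      \sum_(i <- s) c i * fine (nu i O).
    apply: cvg_big => [|i _]; first exact: add_continuous.
    by apply: cvgM; [exact: cvg_cst|exact: lim].
  rewrite (_ : (fun k => _) = cst 0).
    by move=> /(cvg_unique (@norm_hausdorff _ R)) -/(_ _ (cvg_cst _)).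
  apply/funext => k; apply: int0; split; first exact: continuous_subspaceT.
  by exists 1 => x _; have /andP[? ?] := g01 k x; rewrite ger0_norm.
have [m1 [m1E _]] := conic_combination_measure _ s (nneg_part \o c) nu.
have [m2 [m2E _]] := conic_combination_measure _ s (nneg_part \o -%R \o c) nu.
have finB i B : measurable B -> nu i B \is a fin_num by exact: fin_num_measure.
move=> B mB; apply/signed_sum_eq0P; first by move=> i; exact: finB.
rewrite -[LHS]m1E -[RHS]m2E.
(* Open sets are stable under intersection and generate the Borel sets; the constant cover by the
   whole space has finite mass. *)
apply: (@measure_unique _ R (Borel R n) (@open 'rV[R]_n) (fun=> setT) _ _ _ _
  m1 m2) => //.
- by move=> O1 O2; exact: openI.
- by move=> _; exact: openT.
- by rewrite bigcup_const.
- move=> O oO; rewrite m1E m2E; apply/signed_sum_eq0P; last exact: openP.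
  by move=> i; apply: finB; exact: open_Borel.
- move=> _; rewrite m1E; apply: lte_sum_pinfty => i _.
  by rewrite ltey_eq fin_numM ?finB.
Qed.

End borel_euclidean.

(** Greedy choice: a vector outside the current row span is adjoined, which raises the rank, and the
    rank cannot exceed [d]. *)
Lemma row_span_finite {F : fieldType} {d : nat} {X : Type} (V : set X)
    (v : X -> 'rV[F]_d) :
  exists (p : nat) (y : 'I_p -> X), (forall j, V (y j)) /\
    forall x, V x -> (v x <= \matrix_j v (y j))%MS.
Proof.
(* [k] bounds the number of vectors still to be adjoined; the process starts from the empty family
   with [k = d]. *)
suff grow k p (y : 'I_p -> X) : (forall j, V (y j)) ->
    (d <= \rank (\matrix_j v (y j)) + k)%N ->
    exists (q : nat) (z : 'I_q -> X), (forall j, V (z j)) /\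
      forall x, V x -> (v x <= \matrix_j v (z j))%MS.
  apply: (grow d 0%N (fun j => False_rect X (notF (ltn_ord j)))).
    by case.
  exact: leq_addl.
elim: k p y => [|k IH] p y Vy; set M := \matrix_j v (y j).
  rewrite addn0 => rkM; exists p, y; split=> // x _; apply: submx_full.
  by rewrite /row_full eqn_leq rank_leq_col.
move=> rkM; have [all_in|] := pselect (forall x, V x -> (v x <= M)%MS).
  by exists p, y.
move=> /existsNP[x] /not_implyP[Vx /negP xM].
pose z (j : 'I_(p + 1)) := match fintype.split j with inl i => y i | inr _ => x end.
apply: (IH _ z); first by move=> j; rewrite /z; case: fintype.split.
have -> : \matrix_j v (z j) = col_mx M (v x).
  apply/row_matrixP => j; rewrite rowK /z -(splitK j) unsplitK.
  case: (fintype.split j) => i /=; first by rewrite rowKu rowK.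
  by rewrite rowKd row_id.
apply: leq_trans rkM _; rewrite addnS -addSn leq_add2r.
apply: rank_ltmx; rewrite /ltmx col_mx_sub submx_refl/= (negPf xM) andbT.
by rewrite -addsmxE addsmxSl.
Qed.

(** * Norm estimates, compactness and the Jordan decomposition *)

Section euclidean.
Context {R : realType} {d : nat}.
Implicit Types u w : 'rV[R]_d.

Lemma dotvDr u w w' : dotv u (w + w') = dotv u w + dotv u w'.
Proof.
by rewrite /dotv -big_split; apply: eq_bigr => i _; rewrite mxE mulrDr.
Qed.

Lemma dotv_suml {p : nat} (a : 'I_p -> R) (u : 'I_p -> 'rV[R]_d) w :
  dotv (\sum_j a j *: u j) w = \sum_j a j * dotv (u j) w.
Proof.
rewrite /dotv; under eq_bigr do rewrite summxE mulr_suml.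
rewrite exchange_big; apply: eq_bigr => j _; rewrite mulr_sumr.
by apply: eq_bigr => i _; rewrite mxE mulrA.
Qed.

(** After squaring, each term [|w_i|^2] is at most [|w_i|] times the whole sum. *)
Lemma euclid_norm_le_sum w : euclid_norm w <= \sum_i `|w ord0 i|.
Proof.
have S0 : 0 <= \sum_i `|w ord0 i| by apply: sumr_ge0.
rewrite /euclid_norm -[leRHS]ger0_norm// -sqrtr_sqr ler_sqrt ?sqr_ge0//.
rewrite expr2 mulr_suml; apply: ler_sum => i _.
rewrite -real_normK ?num_real// expr2 ler_wpM2l//.
by rewrite (bigD1 i)//= lerDl sumr_ge0.
Qed.

End euclidean.

Lemma supnorm_ge0 {R : realType} {n : nat} (S : set 'rV[R]_n)
  (f : 'rV[R]_n -> R) : 0 <= supnorm S f.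
Proof.
rewrite /supnorm; set E := (X in sup X).
(* [sup] defaults to [0] on an empty or unbounded set. *)
have [hE|/sup_out->//] := pselect (has_sup E).
have [[_ [x Sx _]] _] := hE; apply: le_trans (normr_ge0 (f x)) _.
by apply: (sup_upper_bound hE); exists x.
Qed.

Lemma supnorm_ub {R : realType} {n : nat} (S : set 'rV[R]_n)
  (f : 'rV[R]_n -> R) (x : 'rV[R]_n) :
  in_CS S f -> S x -> `|f x| <= supnorm S f.
Proof.
move=> [_ [M fM]] Sx; apply: ub_le_sup; last by exists x.
by exists M => _ [y Sy <-]; exact: fM.
Qed.

Lemma compact_setX_fst {T U : topologicalType} (S : set T) (A : set U) :
  A !=set0 -> compact (S `*` A) -> compact S.
Proof.
move=> [a Aa] cSA; have -> : S = fst @` (S `*` A).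
  by apply/seteqP; split=> [x Sx|_ [[x y] [Sx _] <-]//]; exists (x, a).
apply: continuous_compact => //; apply: continuous_subspaceT => x; exact: cvg_fst.
Qed.

(** The two parts form a single pair so that [choice] can pick them for all coordinates at once. *)
Lemma charge_jordan {d : measure_display} {T : measurableType d} {R : realType}
    (nu : {charge set T -> \bar R}) :
  exists pq : {finite_measure set T -> \bar R} * {finite_measure set T -> \bar R},
    forall B, measurable B -> nu B = (pq.1 B - pq.2 B)%E.
Proof.
have [P [N PN]] := Hahn_decomposition nu.
exists (jordan_pos PN : {finite_measure set T -> \bar R},
        jordan_neg PN : {finite_measure set T -> \bar R}) => B mB.
by rewrite (jordan_decomp PN)// /cadd/= cscaleN1.
Qed.

(** * Integrals of functions of C(S) against finite measures *)

Section continuous_integral.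
Context {R : realType} {n : nat}.
Variables (S : set 'rV[R]_n) (f : 'rV[R]_n -> R).
Hypotheses (cS : closed S) (CSf : in_CS S f).

Lemma in_CS_measurable :
  measurable_fun (S : set (Borel R n)) (f : Borel R n -> R).
Proof.
by apply: within_continuous_measurable; [exact: closed_Borel|case: CSf].
Qed.

Variable nu : {finite_measure set (Borel R n) -> \bar R}.

Lemma in_CS_integrable : nu.-integrable S (EFin \o f).
Proof.
have mS := closed_Borel _ cS; apply: measurable_bounded_integrable => //.
- by rewrite ltey_eq fin_num_measure.
- exact: in_CS_measurable.
exists (supnorm S f); split; first exact: num_real.
by move=> K /ltW fK x Sx; apply: le_trans fK; exact: supnorm_ub.
Qed.

Lemma le_supnorm_Rintegral :
  `|\int[nu]_(x in S) f x| <= supnorm S f * fine (nu S).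
Proof.
have mS := closed_Borel _ cS; have inf := in_CS_integrable.
apply: le_trans (le_normr_Rintegral mS inf) _.
rewrite -(Rintegral_cst nu mS); apply: le_Rintegral => //.
- exact: (integrable_norm inf).
- exact: finite_measure_integrable_cst.
- by move=> x Sx; exact: supnorm_ub.
Qed.

End continuous_integral.

(** * The two implications, with state-action pairs abstracted to points of [X] *)

Section bellman.
Context {R : realType} {n d : nat} {X : Type}.
Variables (S : set 'rV[R]_n) (V : set X) (v : X -> 'rV[R]_d) (r : X -> R).
Variable P : X -> probability (Borel R n) R.

Lemma linear_model_bellman_complete
    (muh : 'I_d -> {charge set (Borel R n) -> \bar R}) (theta : 'rV[R]_d) :
  closed S ->
  (forall x, V x -> (forall B : set (Borel R n), measurable B ->
     P x B = (\sum_(i < d) (v x ord0 i)%:E * muh i B)%E) /\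
     r x = dotv (v x) theta) ->
  exists C : R, 0 < C /\ forall f, in_CS S f -> exists w : 'rV[R]_d,
    (forall x, V x ->
       ((r x)%:E + \int[P x]_(s in S) (f s)%:E)%E = (dotv (v x) w)%:E) /\
    euclid_norm w <= C * (supnorm S f + 1).
Proof.
move=> cS lin; have mS := closed_Borel _ cS.
have /choice[pq muhE] := fun i => charge_jordan (muh i).
pose mass i := fine ((pq i).1 S) + fine ((pq i).2 S).
have mass0 i : 0 <= mass i by rewrite addr_ge0// fine_ge0.
pose a := \sum_i `|theta ord0 i|; pose b := \sum_i mass i.
have a0 : 0 <= a by apply: sumr_ge0.
have b0 : 0 <= b by apply: sumr_ge0.
(* [a] bounds the norm of [theta], [b] is the total mass on [S] of all Jordan parts, and [1] makes
   the constant positive. *)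
exists (1 + a + b); split; first by rewrite -addrA ltr_pwDl// addr_ge0.
move=> f CSf; have f0 := supnorm_ge0 S f.
pose I i := \int[(pq i).1]_(s in S) f s - \int[(pq i).2]_(s in S) f s.
exists (theta + \row_i I i); split; last first.
  apply: le_trans (euclid_norm_le_sum _) _.
  apply: (@le_trans _ _ (a + supnorm S f * b)).
    rewrite mulr_sumr -big_split/=; apply: ler_sum => i _; rewrite !mxE.
    apply: le_trans (ler_normD _ _) _; rewrite lerD2l mulrDr.
    apply: le_trans (ler_normB _ _) _.
    by apply: lerD; exact: le_supnorm_Rintegral.
  have ? := mulr_ge0 f0 a0; have ? := mulr_ge0 f0 b0.
  rewrite !mulrDl !mulrDr !mulr1 !mul1r (mulrC a) (mulrC b); lra.
move=> x Vx; have [PE ->] := lin x Vx.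
have infx := in_CS_integrable S f cS CSf (P x).
rewrite -(fineK (integrable_fin_num mS infx)) -EFinD; congr EFin.
rewrite dotvDr; congr (_ + _).
(* The remaining equality of integrals is a vanishing signed sum: [P x] has coefficient [1], the
   positive parts [- v_i] and the negative parts [v_i]. *)
pose J : Type := (R * {finite_measure set (Borel R n) -> \bar R})%type.
pose s : seq J := (1, P x : {finite_measure set (Borel R n) -> \bar R}) ::
  ([seq (- v x ord0 i, (pq i).1) | i <- index_enum 'I_d] ++
   [seq (v x ord0 i, (pq i).2) | i <- index_enum 'I_d]).
have sE (F : {finite_measure set (Borel R n) -> \bar R} -> R) :
    \sum_(j <- s) j.1 * F j.2 =
    F (P x) - \sum_i v x ord0 i * (F (pq i).1 - F (pq i).2).
  rewrite /s big_cons big_cat !big_map/= mul1r; congr (_ + _).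
  rewrite -sumrN -big_split; apply: eq_bigr => i _ /=.
  by rewrite mulrBr opprB mulNr addrC.
have := @signed_sum_integral0 _ (Borel R n) R J s fst snd S f (supnorm S f).
rewrite (sE (fun nu => \int[nu]_(s in S) f s)) => int0.
apply/eqP; rewrite -subr_eq0 -[X in _ == X]int0//.
- by apply/eqP; congr (_ - _); apply: eq_bigr => i _; rewrite mxE.
- move=> B mB; rewrite (sE (fun nu => fine (nu B))); apply/eqP.
  rewrite subr_eq0; apply/eqP/EFin_inj; rewrite fineK ?fin_num_measure//.
  rewrite -sumEFin; apply: (etrans (PE B mB)); apply: eq_bigr => i _.
  by rewrite EFinM EFinB !fineK ?fin_num_measure// muhE.
- exact: in_CS_measurable.
- by move=> s' Ss'; exact: supnorm_ub.
Qed.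

Lemma bellman_complete_linear_model :
  closed S -> (forall x, V x -> lives_on S (P x)) ->
  (forall f, in_CS S f -> exists w : 'rV[R]_d, forall x, V x ->
     ((r x)%:E + \int[P x]_(s in S) (f s)%:E)%E = (dotv (v x) w)%:E) ->
  exists (muh : 'I_d -> {charge set (Borel R n) -> \bar R}) (theta : 'rV[R]_d),
    (forall i, lives_on S (muh i)) /\
    (forall x, V x -> (forall B : set (Borel R n), measurable B ->
       P x B = (\sum_(i < d) (v x ord0 i)%:E * muh i B)%E) /\
       r x = dotv (v x) theta).
Proof.
move=> cS PS bell; have [p [y [Vy span]]] := row_span_finite V v.
(* For [v x] in the row span, [v x *m K] gives coefficients of [v x] on the rows of [M]; the entries
   of [K] therefore combine the [P (y j)] into [muh] and the [r (y j)] into [theta]. *)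
set M := \matrix_j v (y j) in span; pose K := pinvmx M.
have /choice[muh muhE] := fun i => @charge_linear_combination _ (Borel R n) R
  'I_p (index_enum _) (K i) (fun j => charge_of_finite_measure (P (y j))).
exists muh, (\row_i \sum_j K i j * r (y j)); split=> [i B mB BS|x Vx].
  rewrite muhE big1// => j _.
  by rewrite [X in (_ * X)%E](PS _ (Vy j) B)// mule0.
pose c := v x *m K.
have vE : v x = \sum_j c ord0 j *: v (y j).
  rewrite -[LHS](mulmxKpV (span x Vx)) mulmx_sum_row.
  by apply: eq_bigr => j _; rewrite rowK.
have bellR f : in_CS S f -> r x + \int[P x]_(s in S) f s =
    \sum_j c ord0 j * (r (y j) + \int[P (y j)]_(s in S) f s).
  move=> /bell[w wE].
  (* A finite right-hand side rules out an infinite integral, so the equality descends to the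
     reals. *)
  have wR z : V z -> r z + \int[P z]_(s in S) f s = dotv (v z) w.
    move=> /wE; rewrite /Rintegral.
    by case: (\int[_]_(_ in _) _)%E => //= q [].
  rewrite wR// vE dotv_suml; by apply: eq_bigr => j _; rewrite wR.
have rE : r x = \sum_j c ord0 j * r (y j).
  have CS0 : in_CS S (fun=> 0).
    split; first by apply: continuous_subspaceT; exact: cst_continuous.
    by exists 0 => s _; rewrite normr0.
  have int0 z : \int[P z]_(s in S) (0 : R) = 0.
    by rewrite /Rintegral integral0.
  have := bellR _ CS0; rewrite int0 addr0 => ->.
  by apply: eq_bigr => j _; rewrite int0 addr0.
(* Exchanging sums turns coefficients on the chosen pairs into coordinates of [v x]. *)
have coefE (F : 'I_p -> R) :
    \sum_j c ord0 j * F j = \sum_i v x ord0 i * \sum_j K i j * F j.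
  under eq_bigr do rewrite mxE mulr_suml.
  rewrite exchange_big; apply: eq_bigr => i _; rewrite mulr_sumr.
  by apply: eq_bigr => j _; rewrite mulrA.
split; last first.
  by rewrite rE coefE; apply: eq_bigr => i _; rewrite mxE.
move=> B mB.
(* [None] indexes [P x] and [Some j] the measure [P (y j)], so that one signed sum expresses their
   difference. *)
pose nu (o : option 'I_p) : {finite_measure set (Borel R n) -> \bar R} :=
  if o is Some j then P (y j) else P x.
pose e o := if o is Some j then - c ord0 j else 1.
pose s := None :: [seq Some j | j <- index_enum 'I_p].
have sE (F : option 'I_p -> R) :
    \sum_(o <- s) e o * F o = F None - \sum_j c ord0 j * F (Some j).
  rewrite big_cons big_map mul1r -sumrN; congr (_ + _).
  by apply: eq_bigr => j _; rewrite mulNr.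
have PB : fine (P x B) = \sum_j c ord0 j * fine (P (y j) B).
  have := @signed_sum_measure0 R n _ s e nu S cS.
  move=> sum0; apply/eqP; rewrite -subr_eq0 -[X in _ == X](sum0 _ _ B mB).
  - by rewrite sE.
  - by case=> [j|]; apply: PS.
  - move=> f CSf; rewrite sE/=; have := bellR f CSf.
    (* The rewards cancel by [rE], leaving an identity between integrals. *)
    under [X in _ = X -> _]eq_bigr do rewrite mulrDr.
    rewrite big_split/= -rE => /addrI ->; exact: subrr.
rewrite -[LHS]fineK ?fin_num_measure// PB coefE -sumEFin; apply: eq_bigr => i _.
rewrite EFinM muhE -sumEFin; congr (_ * _)%E; apply: eq_bigr => j _.
by rewrite EFinM /charge_of_finite_measure fineK ?fin_num_measure.
Qed.

End bellman.

Theorem theorem2 (R : realType) (n m d : nat)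
  (S : set 'rV[R]_n) (A : set 'rV[R]_m) (H : nat)
  (P : nat -> 'rV[R]_n -> 'rV[R]_m -> probability (Borel R n) R)
  (r : nat -> 'rV[R]_n -> 'rV[R]_m -> R) (mu : probability (Borel R n) R)
  (phi : 'rV[R]_n -> 'rV[R]_m -> 'rV[R]_d) (h : nat) :
  is_MDP S A H P r mu ->
  compact (S `*` A) ->
  (1 <= h <= H)%N ->
  ((exists (muh : 'I_d -> {charge set (Borel R n) -> \bar R}) (theta : 'rV[R]_d),
       (forall i, lives_on S (muh i)) /\
       (forall s a, S s -> A a ->
          (forall B : set (Borel R n), measurable B ->
             P h s a B = (\sum_(i < d) ((phi s a) ord0 i)%:E * muh i B)%E) /\
          r h s a = dotv (phi s a) theta))
   <->
   (exists C : R, 0 < C /\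
      forall f : 'rV[R]_n -> R, in_CS S f ->
        exists w : 'rV[R]_d,
          (forall s a, S s -> A a ->
             ((r h s a)%:E + \int[P h s a]_(x in S) (f x)%:E)%E = (dotv (phi s a) w)%:E) /\
          euclid_norm w <= C * (supnorm S f + 1))).
Proof.
move=> [PS _ _ _] cSA hH.
(* With [A] empty the product is compact whatever [S] is, and both statements hold vacuously with
   zero witnesses; otherwise [S] is a projection of the product, hence compact. *)
have [A0|/set0P A0] := eqVneq A set0.
  have nA a : ~ A a by rewrite A0.
  split=> _; last first.
    exists (fun=> czero), 0; split=> [i B _ _ //|s a _ Aa]; by have := nA a Aa.
  exists 1; split=> // f _; exists 0; split=> [s a _ Aa|]; first by have := nA a Aa.
  apply: le_trans (euclid_norm_le_sum _) _.
  rewrite big1 => [|i _]; last by rewrite mxE normr0.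
  by rewrite mul1r addr_ge0// supnorm_ge0.
have cS : closed S.
  apply: compact_closed; first exact: norm_hausdorff.
  exact: compact_setX_fst cSA.
pose V := S `*` A; pose v sa := phi sa.1 sa.2; pose r' sa := r h sa.1 sa.2.
pose P' sa := P h sa.1 sa.2.
split=> [[muh [theta [_ lin]]]|[C [_ bell]]].
  have [|C [C0 bell]] := linear_model_bellman_complete S V v r' P' muh theta cS.
    by move=> [s a] [/= Ss Aa]; exact: lin.
  exists C; split=> // f /bell[w [wE wC]]; exists w; split=> // s a Ss Aa.
  exact: (wE (s, a)).
have [||muh [theta [muhS lin]]] := bellman_complete_linear_model S V v r' P' cS.
- by move=> [s a] [/= Ss Aa]; exact: PS.
- move=> f /bell[w [wE _]]; exists w => -[s a] [/= Ss Aa]; exact: wE.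
- exists muh, theta; split=> // s a Ss Aa; exact: (lin (s, a)).
Qed.
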